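(* Consider the radial weight $$h(r)=\begin{cases}0,&0\le r\le 1,\\ \tfrac12(\log r)^{3/2},& r>1,\end{cases}$$ and the weighted Fock space $\mathcal{A}_h(\mathbb{C})$. The uniform closure (closure in $\ell^\infty(\mathbb{N}_0)$) of the set of eigenvalue sequences $$\left\{(\lambda_{\varphi,m})_{m\in\mathbb{N}_0}:\varphi\in L^\infty(\mathbb{C})\text{ is radial}\right\}$$ does not coincide with the $C^*$-algebra of all bounded sequences on $\mathbb{N}_0$ that are uniformly continuous with respect to the square-root metric $\rho(m,n)=|\sqrt m-\sqrt n|$.
   Context: $\mathbb{N}_0=\{0,1,2,\dots\}$. Put $h(z):=h(|z|)$ for $z\in\mathbb{C}$. $L^2_h(\mathbb{C})$ is the Hilbert space of measurable functions with $\|f\|_h^2=\int_{\mathbb{C}}|f(z)|^2e^{-2h(z)}\,dz<\infty$ ($dz$ Lebesgue measure), $\mathcal{A}_h(\mathbb{C})$ is its closed subspace of entire functions, $P:L_h^2(\mathbb{C})\to\mathcal{A}_h(\mathbb{C})$ is the orthogonal projection, and $T_\varphi f=P(\varphi f)$ for $\varphi\in L^\infty(\mathbb{C})$. For a radial symbol $\varphi(z)=a(|z|)$ (a.e.), $T_\varphi$ acts on $P^m(\mathbb{C})=\mathbb{C}z^m$ as the scalar $$\lambda_{\varphi,m}=\frac{\int_0^\infty a(u)\,u^{2m+1}e^{-2h(u)}\,du}{\int_0^\infty u^{2m+1}e^{-2h(u)}\,du},\qquad m\in\mathbb{N}_0,$$ and $(\lambda_{\varphi,m})_{m\in\mathbb{N}_0}$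 is the eigenvalue sequence of $\varphi$. *)

(* Defs.v *)
From HB Require Import structures.
From mathcomp Require Import all_boot all_order all_algebra.
From mathcomp Require Import all_classical all_reals all_analysis.
From mathcomp Require Import ess_sup_inf complex.

Set Implicit Arguments.
Unset Strict Implicit.
Unset Printing Implicit Defensive.

Import Order.TTheory GRing.Theory Num.Theory numFieldNormedType.Exports.

Local Open Scope classical_set_scope.
Local Open Scope ring_scope.
Local Open Scope complex_scope.

(* The complex plane carries the measurable structure and the Lebesgue measure
   of R * R, transported by (x, y) |-> x + iy. *)
Definition to_complex (R : realType)
    (z : measurableTypeR R * measurableTypeR R) : R[i] := z.1 +i* z.2.

Definition plane_measure (R : realType) :
    {measure set (measurableTypeR R * measurableTypeR R) -> \bar R} :=
  (@lebesgue_measure R \x @lebesgue_measure R)%E.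

Definition cmeasurable (R : realType) (d : measure_display)
    (T : measurableType d) (D : set T) (f : T -> R[i]) : Prop :=
  measurable_fun D (fun x => complex.Re (f x)) /\
  measurable_fun D (fun x => complex.Im (f x)).

Definition cintegral (R : realType) (d : measure_display)
    (T : measurableType d) (mu : {measure set T -> \bar R}) (D : set T)
    (f : T -> R[i]) : R[i] :=
  (\int[mu]_(x in D) complex.Re (f x)) +i* (\int[mu]_(x in D) complex.Im (f x)).

Definition Linfty (R : realType) (phi : R[i] -> R[i]) : Prop :=
  cmeasurable setT (phi \o @to_complex R) /\
  (ess_sup (@plane_measure R)
     (fun z => (Normc.normc (phi (to_complex z)))%:E) < +oo)%E.

(* phi(z) = a(|z|) for almost every z *)
Definition radial_symbol (R : realType) (phi : R[i] -> R[i]) (a : R -> R[i]) :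
    Prop :=
  cmeasurable (`[0, +oo[ : set (measurableTypeR R)) a /\
  {ae @plane_measure R, forall z,
     phi (to_complex z) = a (Normc.normc (to_complex z))}.

(* The scalar by which the Toeplitz operator with symbol a(|z|) on the Fock
   space with weight exp(-2h) acts on the monomials z^m. *)
Definition eigenvalue_seq (R : realType) (h : R -> R) (a : R -> R[i]) (m : nat) :
    R[i] :=
  cintegral lebesgue_measure `[0, +oo[
    (fun u => a u * (u ^+ (2 * m + 1) * expR (- 2 * h u))%:C) /
  (\int[lebesgue_measure]_(u in `[0, +oo[)
     (u ^+ (2 * m + 1) * expR (- 2 * h u)))%:C.

Definition radial_eigenvalue_seqs (R : realType) (h : R -> R) :
    set (nat -> R[i]) :=
  [set lam | exists (phi : R[i] -> R[i]) (a : R -> R[i]),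
     [/\ Linfty phi, radial_symbol phi a & lam = eigenvalue_seq h a]].

Definition ell_infty (R : realType) : set (nat -> R[i]) :=
  [set u | exists M : R, forall n, Normc.normc (u n) <= M].

(* {uniform nat -> R[i]^o} is the space of all sequences with the topology of
   uniform convergence, of which the Banach space ell_infty is a subspace. *)
Definition ell_infty_closure (R : realType) (S : set (nat -> R[i])) :
    set (nat -> R[i]) :=
  @ell_infty R `&` closure (S : set {uniform nat -> (R[i])^o}).

Definition sqrt_metric (R : realType) (m n : nat) : R :=
  `|Num.sqrt m%:R - Num.sqrt n%:R|.

Definition sqrt_unif_continuous (R : realType) (u : nat -> R[i]) : Prop :=
  forall e : R, 0 < e -> exists2 d : R, 0 < d &
    forall m n : nat, sqrt_metric R m n < d -> Normc.normc (u m - u n) < e.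

Definition bounded_sqrt_unif_continuous (R : realType) : set (nat -> R[i]) :=
  [set u | ell_infty u /\ sqrt_unif_continuous u].

Definition log32_weight (R : realType) (r : R) : R :=
  if r <= 1 then 0 else 2^-1 * (ln r) `^ (3 / 2).

(* Main.v *)
(* Write M_m for the m-th moment of u e^{-2h(u)} du on the half line, taken in
   the variable u^2.  M_m is at least e^{m^3 - 2}, whereas bounded ratios
   M_{p+1}^2 / (M_p M_{p+2}) would only allow growth e^{O(m^2)}; so for
   infinitely many p the quotient M_{p+1}^2 / (M_p M_{p+2}) is as small as we
   like.  For such a p put b^4 = M_{p+2} / M_p: by Markov's inequality almost
   all the mass of the p-th eigenvalue measure lies to the left of b, and
   almost all the mass of the (p+2)-nd one to the right of b.  Along a sparse
   sequence of such p, the indicator of a union of intervals [b, d[ is thus a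
   symbol with lambda_p <= 1/4 and lambda_{p+2} >= 3/4, while
   sqrt (p + 2) - sqrt p -> 0. *)
Require Import Defs.
From mathcomp Require Import all_boot all_order all_algebra.
From mathcomp Require Import all_classical all_reals all_analysis.
From mathcomp Require Import complex measurable_realfun ess_sup_inf ring lra zify.

Set Implicit Arguments.
Unset Strict Implicit.
Unset Printing Implicit Defensive.

Import Order.TTheory GRing.Theory Num.Theory numFieldNormedType.Exports.

Local Open Scope classical_set_scope.
Local Open Scope ring_scope.
Local Open Scope complex_scope.

Section moments.
Context {R : realType}.
Implicit Types (u s c : R) (m k n p : nat).

(** * Moments of the weight and their finiteness *)

Definition density m u : R := u ^+ (2 * m + 1) * expR (- 2 * log32_weight u).

Definition moment m : R := \int[lebesgue_measure]_(u in `[0, +oo[) density m u.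

Lemma powR32 s : 0 <= s -> s `^ (3 / 2) = s * Num.sqrt s.
Proof.
move=> s0; have h : 0 < 3 / 2 :> R by lra.
rewrite -(mulr_powRB1 s0 h).
by rewrite -powR12_sqrt//; congr (_ * _ `^ _); lra.
Qed.

Lemma log32_weight_ge0 u : 0 <= log32_weight u.
Proof. by rewrite /log32_weight; case: ifP => // _; rewrite mulr_ge0 ?powR_ge0. Qed.

Lemma measurable_log32_weight : measurable_fun setT (@log32_weight R).
Proof.
apply: measurable_fun_ifT; [exact: measurable_fun_ler|exact: measurable_cst|].
apply: measurable_funM => //.
exact: measurableT_comp (measurable_powR _) (@measurable_ln R).
Qed.

Lemma density_ge0 m u : 0 <= u -> 0 <= density m u.
Proof. by move=> u0; rewrite mulr_ge0 ?exprn_ge0 ?expR_ge0. Qed.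

Lemma densityD m k u : density (m + k) u = u ^+ (2 * k) * density m u.
Proof.
rewrite /density mulrA -exprD; congr (_ ^+ _ * _); lia.
Qed.

Lemma densityS m u : density m.+1 u = u ^+ 2 * density m u.
Proof. by rewrite -addn1 densityD. Qed.

Lemma measurable_density m : measurable_fun setT (density m).
Proof.
apply: measurable_funM; first exact: measurable_funX.
apply: measurableT_comp => //; apply: measurable_funM => //.
exact: measurable_log32_weight.
Qed.

(** This integrable majorant makes every moment finite. Once [sqrt (ln u) >= 2m + 3], the weight
    factor [exp (- ln u * sqrt (ln u))] is at most [u ^- (2m + 3)] and absorbs all powers of [u];
    below that threshold a crude bound suffices. *)
Lemma density_le_oneDsqrV m :
  exists K, forall u, 0 <= u -> density m u <= K * (oneDsqr u)^-1.
Proof.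
(* [K] is [u ^ (2m + 1) * (2 * u ^ 2)] at the cut-off [u = exp (a ^ 2)]. *)
set a : R := (2 * m + 3)%:R; pose K : R := 2 * expR (a ^+ 3).
have a0 : 0 <= a by exact: ler0n.
exists K => u u0.
rewrite ler_pdivlMr ?oneDsqr_gt0// /oneDsqr.
have [uT|Tu] := leP u (expR (a ^+ 2)).
  have e1 : expR (- 2 * log32_weight u) <= 1.
    rewrite -[leRHS]expR0 ler_expR; have := log32_weight_ge0 u; lra.
  have h1 : u ^+ (2 * m + 1) <= expR (a ^+ 2) ^+ (2 * m + 1).
    by rewrite lerXn2r// nnegrE expR_ge0.
  have h2 : 1 + u ^+ 2 <= 2 * expR (a ^+ 2) ^+ 2.
    have h3 : u ^+ 2 <= expR (a ^+ 2) ^+ 2 by rewrite lerXn2r// nnegrE expR_ge0.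
    have h4 : 1 <= expR (a ^+ 2) ^+ 2.
      by rewrite exprn_ege1// -[leLHS]expR0 ler_expR exprn_ge0.
    lra.
  have -> : K = expR (a ^+ 2) ^+ (2 * m + 1) * 1 * (2 * expR (a ^+ 2) ^+ 2).
    rewrite mulr1 mulrCA -exprD -addnA -expRM_natl /K exprS.
    by congr (_ * expR (_%:R * _)); lia.
  by rewrite ler_pM ?ler_pM ?mulr_ge0 ?exprn_ge0 ?expR_ge0 ?addr_ge0 ?sqr_ge0.
have u1 : 1 <= u.
  by apply: le_trans (ltW Tu); rewrite -[leLHS]expR0 ler_expR exprn_ge0.
have lnu : a ^+ 2 <= ln u.
  by rewrite -(expRK (a ^+ 2)) ler_ln ?posrE ?expR_gt0 ?(ltW Tu)//; lra.
have lnu0 : 0 <= ln u by rewrite (le_trans _ lnu)// sqr_ge0.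
have u_gt1 : (u <= 1) = false.
  apply/negbTE; rewrite -ltNge (le_lt_trans _ Tu)// -[leLHS]expR0 ler_expR.
  by rewrite sqr_ge0.
rewrite /density /log32_weight u_gt1 powR32//.
apply: (@le_trans _ _ (2 * (u ^+ (2 * m + 3) * expR (- 2 * (2^-1 * (ln u * Num.sqrt (ln u))))))).
  have -> : (2 * m + 3 = (2 * m + 1) + 2)%N by lia.
  rewrite [u ^+ (_ + 2)]exprD.
  have hu : 1 + u ^+ 2 <= 2 * u ^+ 2.
    have h : 1 <= u ^+ 2 by exact: exprn_ege1.
    lra.
  set e := expR _; set b := u ^+ (2 * m + 1).
  have be0 : 0 <= b * e by rewrite mulr_ge0 ?expR_ge0 ?exprn_ge0.
  rewrite [leRHS](_ : _ = b * e * (2 * u ^+ 2)); last by ring.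
  exact: ler_wpM2l.
rewrite ler_pM2l// -[u in u ^+ _]lnK ?posrE; last by lra.
rewrite -expRM_natl -expRD ler_expR.
have : a <= Num.sqrt (ln u) by rewrite -(ger0_norm a0) -sqrtr_sqr ler_sqrt.
rewrite -mulr_natl -/a => h.
have : 0 <= a ^+ 3 by rewrite exprn_ge0.
have : 0 <= ln u * (Num.sqrt (ln u) - a) by rewrite mulr_ge0// subr_ge0.
lra.
Qed.

Lemma integrable_density m :
  lebesgue_measure.-integrable `[0, +oo[ (EFin \o density m).
Proof.
have [K HK] := density_le_oneDsqrV m.
have int_bound : lebesgue_measure.-integrable `[0, +oo[
    (fun u : measurableTypeR R => K%:E * ((oneDsqr (u : R))^-1)%:E)%E.
  apply: integrableZl => //.
  apply/integrableP; split.
    apply/measurable_EFinP/measurable_funTS.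
    by apply: continuous_measurable_fun; exact: continuous_oneDsqrV.
  under eq_integral do rewrite gee0_abs ?lee_fin ?invr_ge0 ?oneDsqr_ge0//.
  by rewrite integral0y_oneDsqr ltry.
apply: (le_integrable _ _ _ int_bound) => //.
- by apply/measurable_EFinP/measurable_funTS; exact: measurable_density.
- move=> u /=; rewrite in_itv/= andbT => u0.
  rewrite lee_fin ger0_norm ?density_ge0//.
  exact: le_trans (HK _ u0) (ler_norm _).
Qed.

(** * Growth of the moments *)

Lemma momentE m :
  (moment m)%:E = (\int[lebesgue_measure]_(u in `[0%R, +oo[) (density m u)%:E)%E.
Proof.
rewrite /moment /Rintegral fineK//; apply: integrable_fin_num => //.
exact: integrable_density.
Qed.

(* At u = exp s the density is exp ((2m + 1) s - s ^ (3/2)), with maximum of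
   order exp (c m ^ 3) near s = 16 m ^ 2 / 9; s = m ^ 2 already shows this
   growth. *)
Lemma moment_ge m : (0 < m)%N -> expR (m%:R ^+ 3 - 2) <= moment m.
Proof.
(* Only [[e^S, e^(S+1)]] is used; its length is at least 1. There [ln u <= a^2], and the exponent is
   at least [(2a + 1)(a^2 - 1) - a^3 = a^3 - 2 + (a - 1)^2]. *)
move=> m0; set a : R := m%:R; pose S := a ^+ 2 - 1.
have a1 : 1 <= a by rewrite ler1n.
have S0 : 0 <= S by rewrite /S; nra.
have le_density u : u \in `[expR S, expR (S + 1)] -> expR (a ^+ 3 - 2) <= density m u.
  rewrite in_itv/= => /andP[lu uu].
  have u0 : 0 < u by apply: lt_le_trans lu; exact: expR_gt0.
  have hw : 2 * log32_weight u <= a ^+ 3.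
    rewrite /log32_weight; case: ifPn => [_|]; first by rewrite mulr0 exprn_ge0; lra.
    rewrite -ltNge => u1.
    have ln0 : 0 <= ln u by apply: ln_ge0; exact: ltW.
    have lnu : ln u <= a ^+ 2.
      rewrite (_ : a ^+ 2 = S + 1); last by rewrite /S; ring.
      by rewrite -(expRK (S + 1)) ler_ln ?posrE ?expR_gt0.
    have sq : Num.sqrt (ln u) <= a.
      by rewrite -(ger0_norm (ltW (lt_le_trans ltr01 a1))) -sqrtr_sqr ler_wsqrtr.
    rewrite powR32// mulrA divff// mul1r exprSr.
    by rewrite ler_pM ?sqrtr_ge0.
  have hu : expR ((2 * m + 1)%:R * S) <= u ^+ (2 * m + 1).
    by rewrite expRM_natl lerXn2r// nnegrE ?expR_ge0 ?ltW.
  apply: (@le_trans _ _ (expR ((2 * m + 1)%:R * S) * expR (- 2 * log32_weight u))).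
    rewrite -expRD ler_expR natrD natrM -/a /S.
    have : 0 <= (a - 1) ^+ 2 by exact: sqr_ge0.
    nra.
  by rewrite ler_wpM2r ?expR_ge0.
have len1 : 1 <= expR (S + 1) - expR S.
  rewrite expRD; have h1 := expR_ge1Dx (1 : R).
  have h2 := expR_ge1Dx S; nra.
rewrite -lee_fin momentE.
have sub : `[expR S, expR (S + 1)] `<=` (`[0, +oo[ : set R).
  by move=> u /=; rewrite !in_itv/= andbT => /andP[+ _]; apply: le_trans; exact: expR_ge0.
have le_int : (\int[lebesgue_measure]_(u in `[expR S, expR (S + 1)]) (density m u)%:E <=
    \int[lebesgue_measure]_(u in `[0%R, +oo[) (density m u)%:E)%E.
  apply: ge0_subset_integral => //.
    by apply/measurable_EFinP/measurable_funTS; exact: measurable_density.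
  by move=> u /=; rewrite in_itv/= andbT lee_fin => /density_ge0.
apply: le_trans le_int.
apply: (@le_trans _ _ (\int[lebesgue_measure]_(u in `[expR S, expR (S + 1)])
   (expR (a ^+ 3 - 2))%:E)%E); last first.
  apply: ge0_le_integral => //.
  by apply/measurable_EFinP/measurable_funTS; exact: measurable_density.
rewrite integral_cst//= lebesgue_measure_itv/= lte_fin ltr_expR ltrDl ltr01.
by rewrite -EFinD -EFinM lee_fin ler_peMr ?expR_ge0.
Qed.

Lemma moment_gt0 m : (0 < m)%N -> 0 < moment m.
Proof. by move=> /moment_ge; apply: lt_le_trans; exact: expR_gt0. Qed.

Lemma moment_ge0 m : 0 <= moment m.
Proof. by apply: Rintegral_ge0 => u /=; rewrite in_itv/= andbT; exact: density_ge0. Qed.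

Lemma moment_growth (x y : R) : 1 <= x -> 1 <= y ->
  exists n, forall p, (n <= p)%N -> x ^+ (p ^ 2) * y <= moment p.
Proof.
(* For [p >= x + y + 2], the cube [p^3] dominates [p^2 * x + y + 2], while [x <= e^x] and
   [y <= e^y]. *)
move=> x1 y1; exists (Num.trunc (x + y + 2)).+1 => p np.
have p0 : (0 < p)%N by exact: leq_trans np.
apply: le_trans (moment_ge p0).
have xp : x + y + 2 <= p%:R.
  apply/ltW/(lt_le_trans (truncnS_gt _)); by rewrite ler_nat.
have hx : x ^+ (p ^ 2) <= expR ((p ^ 2)%:R * x).
  rewrite expRM_natl lerXn2r ?nnegrE ?expR_ge0//; first by lra.
  have := expR_ge1Dx x; lra.
have hy : y <= expR y by have := expR_ge1Dx y; lra.
apply: (@le_trans _ _ (expR ((p ^ 2)%:R * x) * expR y)).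
  by apply: ler_pM => //; rewrite ?exprn_ge0; lra.
rewrite -expRD ler_expR natrX.
have p1 : 1 <= p%:R :> R by rewrite ler1n.
have p2 : 1 <= p%:R ^+ 2 :> R by rewrite exprn_ege1.
have : p%:R ^+ 2 * (x + y + 2) <= p%:R ^+ 3 by rewrite [leRHS]exprSr ler_wpM2l// sqr_ge0.
nra.
Qed.

(** * Comparison of neighbouring moments *)

Lemma integrable_density2 c d n k : lebesgue_measure.-integrable `[0, +oo[
  (EFin \o (fun u => c * density n u + d * density k u)).
Proof.
rewrite (_ : _ \o _ = (fun u => c%:E * (density n u)%:E + d%:E * (density k u)%:E)%E); last first.
  by apply/funext => u /=; rewrite EFinD !EFinM.
by apply: integrableD => //; apply: integrableZl => //; exact: integrable_density.
Qed.

Lemma Rintegral_density2 c d n k :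
  \int[lebesgue_measure]_(u in `[0, +oo[) (c * density n u + d * density k u) =
  c * moment n + d * moment k.
Proof.
have i e j : lebesgue_measure.-integrable `[0, +oo[ (EFin \o (fun u => e * density j u)).
  rewrite (_ : _ \o _ = (fun u => e%:E * (density j u)%:E)%E); last first.
    by apply/funext => u /=; rewrite EFinM.
  by apply: integrableZl => //; exact: integrable_density.
rewrite RintegralD//.
by rewrite !RintegralZl//; exact: integrable_density.
Qed.

Lemma moment_le m c d n k :
  (forall u, 0 <= u -> density m u <= c * density n u + d * density k u) ->
  moment m <= c * moment n + d * moment k.
Proof.
move=> h; rewrite -Rintegral_density2; apply: le_Rintegral => //.
- exact: integrable_density.
- exact: integrable_density2.
- by move=> u /=; rewrite in_itv/= andbT; exact: h.
Qed.

(** Cut the [p]-th moment at [u^2 = 2c]. The left part is at most [(2c)^p * moment 0], which by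
    [moment_growth] is at most half of [moment p] for large [p]; the right part is at most
    [moment p.+1 / (2c)]. *)
Lemma moment_ratio c : 1 <= c ->
  exists n, forall p, (n <= p)%N -> c * moment p <= moment p.+1.
Proof.
move=> c1; pose x := 2 * c.
have x1 : 1 <= x by rewrite /x; lra.
have M0 := moment_ge0 0.
have y1 : 1 <= 1 + 2 * moment 0 by lra.
have [n hn] := moment_growth x1 y1.
exists n => p np.
have h1 : moment p <= x ^+ p * moment 0 + x^-1 * moment p.+1.
  apply: moment_le => u u0.
  have d0 := density_ge0 0 u0; have dp := density_ge0 p u0.
  have dE : density p u = (u ^+ 2) ^+ p * density 0 u by rewrite -exprM -densityD.
  have dE1 : density p.+1 u = u ^+ 2 * density p u by rewrite -addn1 densityD.
  have x0 : 0 < x by lra.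
  have [ux|xu] := leP (u ^+ 2) x.
    apply: (@le_trans _ _ (x ^+ p * density 0 u)).
      by rewrite dE ler_wpM2r// lerXn2r// nnegrE ?sqr_ge0 ?ltW.
    by rewrite lerDl mulr_ge0 ?invr_ge0 ?(ltW x0)// density_ge0.
  apply: (@le_trans _ _ (x^-1 * density p.+1 u)).
    by rewrite dE1 mulrA ler_peMl// mulrC ler_pdivlMr// mul1r ltW.
  by rewrite lerDr mulr_ge0// exprn_ge0// ltW.
have h2 : x ^+ p * (2 * moment 0) <= moment p.
  apply: le_trans (hn _ np); apply: ler_pM => //.
  - by rewrite exprn_ge0//; lra.
  - by rewrite mulr_ge0.
  - by rewrite ler_weXn2l// -mulnn; nia.
  - by rewrite lerDr.
have h3 : x * moment p <= 2 * moment p.+1.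
  have h4 : moment p <= 2 * (x^-1 * moment p.+1) by lra.
  have x0 : 0 < x by lra.
  by have := ler_wpM2l (ltW x0) h4; rewrite [leRHS]mulrCA mulVKf ?gt_eqF.
move: h3; rewrite /x; lra.
Qed.

(* Otherwise log (moment p) would have bounded second differences, hence grow
   at most quadratically. *)
Lemma moment_gap c n : 1 <= c ->
  exists2 p, (n <= p)%N & c * moment p.+1 ^+ 2 <= moment p * moment p.+2.
Proof.
move=> c1; apply: contrapT => /forall2NP H.
have {}H p : (n.+1 <= p)%N -> moment p * moment p.+2 <= c * moment p.+1 ^+ 2.
  by move=> np; case: (H p) => [|/negP]; rewrite ?(ltnW np)// -ltNge => /ltW.
(* By [H], consecutive quotients of moments grow by at most a factor [c] per step, so the [k]-th is
   at most [r * c^k]. Starting at [n.+1] keeps the index positive, as [moment_gt0] requires. *)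
pose r := 1 + moment n.+2 / moment n.+1.
have Mn : 0 < moment n.+1 by exact: moment_gt0.
have r1 : 1 <= r by rewrite lerDl divr_ge0 ?moment_ge0.
have ratio k : moment (n.+1 + k).+1 <= r * c ^+ k * moment (n.+1 + k).
  elim: k => [|k IH].
    by rewrite expr0 mulr1 addn0 mulrDl divfK ?gt_eqF// lerDr mul1r ltW.
  rewrite addnS; have Mk : 0 < moment (n.+1 + k) by exact: moment_gt0.
  rewrite -(ler_pM2l Mk); apply: le_trans (H _ (leq_addr _ _)) _.
  have := moment_ge0 (n.+1 + k).+1 => M1.
  have := ler_wpM2l (mulr_ge0 (le_trans ler01 c1) M1) IH.
  rewrite (exprS c k); congr (_ <= _); ring.
(* The exponents [2k + 1] of the successive quotients add up to a square. *)
have bound k : moment (n.+1 + k) <= (r * c) ^+ (k ^ 2) * moment n.+1.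
  elim: k => [|k IH]; first by rewrite addn0 mul1r.
  rewrite addnS; apply: le_trans (ratio k) _.
  have h : r * c ^+ k <= (r * c) ^+ (2 * k + 1).
    rewrite exprMn ler_pM ?exprn_ge0//; try lra.
      by rewrite -[leLHS]expr1 ler_weXn2l//; lia.
    by rewrite ler_weXn2l//; lia.
  have -> : (k.+1 ^ 2 = (2 * k + 1) + k ^ 2)%N by lia.
  have rc0 : 0 <= r * c ^+ k by rewrite mulr_ge0 ?exprn_ge0//; lra.
  by rewrite exprD -[leRHS]mulrA; apply: ler_pM => //; exact: moment_ge0.
have rc1 : 1 <= r * c by nra.
(* The added 1 makes the final comparison strict. *)
have y1 : 1 <= 1 + moment n.+1 by rewrite lerDl moment_ge0.
have [k hk] := moment_growth rc1 y1.
have := hk (n.+1 + k)%N (leq_addl _ _); apply/negP; rewrite -ltNge.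
apply: le_lt_trans (bound k) _.
have h : (r * c) ^+ (k ^ 2) <= (r * c) ^+ ((n.+1 + k) ^ 2).
  by rewrite ler_weXn2l// leq_sqr leq_addl.
have : 0 < (r * c) ^+ ((n.+1 + k) ^ 2) by rewrite exprn_gt0//; lra.
nra.
Qed.

(** One stage of the construction: [c] is the end of the previous interval and [[b, d[] is the new
    one. The four terms on the left are Markov bounds for the [p]-th mass on [[0, c[] and beyond
    [b], and for the [p.+2]-nd mass on [[0, b[] and beyond [d]. *)
Lemma moment_step c n : 1 <= c -> exists x : nat * R * R,
  let: (p, b, d) := x in
  [/\ (n < p)%N, c <= b, b <= d,
      c ^+ (2 * p) * moment 0 + b ^- 2 * moment p.+1 <= moment p / 4 &
      b ^+ 2 * moment p.+1 + d ^- 2 * moment p.+3 <= moment p.+2 / 4].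
Proof.
move=> c1.
have c2 : 1 <= c ^+ 2 by exact: exprn_ege1.
have M0 := moment_ge0 0.
have y1 : 1 <= 1 + 8 * moment 0 by lra.
have [n1 hn1] := moment_growth c2 y1.
have [n2 hn2] := moment_ratio c2.
(* Each of the four terms will be at most an eighth of its moment; [64 = 8 ^ 2] because the gap
   compares squares. The thresholds [n1] and [n2] serve the term in [c] and the bound [c <= b]. *)
have [p np gap] := @moment_gap 64 (n.+1 + n1 + n2) ltac:(lra).
have [np' n1p n2p] : [/\ n < p, n1 <= p & n2 <= p]%N by split; lia.
have p0 : (0 < p)%N by exact: leq_ltn_trans np'.
have Mp : 0 < moment p by exact: moment_gt0.
have Mp1 : 0 < moment p.+1 by exact: moment_gt0.
have Mp2 : 0 < moment p.+2 by exact: moment_gt0.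
have Mp3 : 0 < moment p.+3 by exact: moment_gt0.
(* With [b^2 = x] the two terms in [b], relative to [moment p] and [moment p.+2], both equal [moment
   p.+1 / sqrt (moment p * moment p.+2)]. *)
pose x : R := Num.sqrt (moment p.+2 / moment p).
have x0 : 0 < x by rewrite sqrtr_gt0 divr_gt0.
have xx : x ^+ 2 * moment p = moment p.+2.
  by rewrite sqr_sqrtr ?divfK ?gt_eqF// divr_ge0 ?ltW.
have cx : c ^+ 2 <= x.
  rewrite -(ger0_norm (sqr_ge0 c)) -sqrtr_sqr ler_wsqrtr// ler_pdivlMr//.
  have h1 : c ^+ 2 * moment p <= moment p.+1 by apply: hn2; rewrite ?(leq_trans n2p)//.
  have h2 : c ^+ 2 * moment p.+1 <= moment p.+2 by apply: hn2; rewrite ?(leq_trans n2p)//.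
  apply: le_trans h2; rewrite [(_ ^+ 2) ^+ 2]expr2 -mulrA ler_wpM2l//; lra.
pose b : R := Num.sqrt x.
have bb : b ^+ 2 = x by rewrite sqr_sqrtr// ltW.
have b1 : 1 <= b by rewrite -sqrtr1 ler_wsqrtr//; lra.
(* Since [d >= 1], already [d * moment p.+2 / 8 >= moment p.+3] gives the bound with [d ^ 2]; the
   summand [b] ensures [b <= d]. *)
pose d : R := b + 8 * (moment p.+3 / moment p.+2).
have r0 : 0 < moment p.+3 / moment p.+2 by rewrite divr_gt0.
exists (p, b, d); split => //.
- rewrite -(ger0_norm (le_trans ler01 c1)) -sqrtr_sqr ler_wsqrtr//.
- by rewrite /d; lra.
- have h1 : c ^+ (2 * p) * moment 0 <= moment p / 8.
    have h : c ^+ (2 * p) * (8 * moment 0) <= moment p.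
      apply: le_trans (hn1 p n1p).
      rewrite exprM; apply: ler_pM; rewrite ?mulr_ge0 ?exprn_ge0//; try lra.
      by rewrite ler_weXn2l// -mulnn leq_pmulr.
    lra.
  have h2 : b ^- 2 * moment p.+1 <= moment p / 8.
    rewrite bb mulrC ler_pdivrMr//.
    suff : moment p.+1 ^+ 2 <= (moment p / 8 * x) ^+ 2.
      by rewrite ler_pXn2r// nnegrE ?mulr_ge0 ?divr_ge0// ltW.
    rewrite [leRHS](_ : _ = moment p * moment p.+2 / 64); last by rewrite -xx; field.
    by rewrite ler_pdivlMr// mulrC.
  lra.
- have h1 : b ^+ 2 * moment p.+1 <= moment p.+2 / 8.
    rewrite bb.
    suff : (x * moment p.+1) ^+ 2 <= (moment p.+2 / 8) ^+ 2.
      by rewrite ler_pXn2r// nnegrE ?mulr_ge0 ?divr_ge0// ltW.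
    rewrite [leRHS](_ : _ = moment p.+2 ^+ 2 / 64); last by field.
    rewrite ler_pdivlMr// mulrC exprMn mulrCA.
    have := ler_wpM2l (sqr_ge0 x) gap.
    by rewrite [leRHS]mulrA xx -expr2.
  have d1 : 1 <= d by rewrite /d; lra.
  have h2 : d ^- 2 * moment p.+3 <= moment p.+2 / 8.
    rewrite mulrC ler_pdivrMr ?exprn_gt0//; last by lra.
    have : d * (moment p.+2 / 8) <= d ^+ 2 * (moment p.+2 / 8).
      by rewrite ler_wpM2r ?divr_ge0 ?(ltW Mp2)// ler_eXnr.
    have : moment p.+3 <= d * (moment p.+2 / 8).
      rewrite /d mulrDl.
      have -> : 8 * (moment p.+3 / moment p.+2) * (moment p.+2 / 8) = moment p.+3.
        by field; rewrite gt_eqF.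
      by rewrite lerDr; apply: mulr_ge0; lra.
    lra.
  lra.
Qed.

Lemma density2_ge0 c d n k u : 0 <= c -> 0 <= d -> 0 <= u ->
  0 <= c * density n u + d * density k u.
Proof. by move=> c0 d0 u0; rewrite addr_ge0// mulr_ge0// density_ge0. Qed.

(** * Indicator symbols and their eigenvalues *)

Definition mass (A : set R) m : R :=
  \int[lebesgue_measure]_(u in `[0, +oo[) (\1_A u * density m u).

Lemma integrable_indic_density (A : set (measurableTypeR R)) m : measurable A ->
  lebesgue_measure.-integrable `[0, +oo[ (EFin \o (fun u => \1_A u * density m u)).
Proof.
move=> mA; apply: (le_integrable _ _ _ (integrable_density m)) => //.
  apply/measurable_EFinP/measurable_funTS; apply: measurable_funM => //.
  exact: measurable_density.
move=> u /=; rewrite in_itv/= andbT => u0.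
rewrite lee_fin normrM ler_piMl// indicE.
by case: (u \in A); rewrite ?normr1 ?normr0.
Qed.

Lemma mass_ge0 A m : 0 <= mass A m.
Proof.
apply: Rintegral_ge0 => u /=; rewrite in_itv/= andbT => u0.
by rewrite mulr_ge0 ?density_ge0// indicE ler0n.
Qed.

Lemma mass_le (A : set (measurableTypeR R)) m c d n k : measurable A ->
  (forall u, 0 <= u -> A u -> density m u <= c * density n u + d * density k u) ->
  0 <= c -> 0 <= d ->
  mass A m <= c * moment n + d * moment k.
Proof.
move=> mA h c0 d0; rewrite -Rintegral_density2; apply: le_Rintegral => //.
- exact: integrable_indic_density.
- exact: integrable_density2.
- move=> u /=; rewrite in_itv/= andbT => u0; rewrite indicE.
  case: (boolP (u \in A)) => [/set_mem uA|_]; first by rewrite mul1r h.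
  by rewrite mul0r density2_ge0.
Qed.

(** Domination is needed off [A] only: on [A] the indicator itself accounts for [density m]. *)
Lemma mass_ge (A : set (measurableTypeR R)) m c d n k : measurable A ->
  (forall u, 0 <= u -> ~ A u -> density m u <= c * density n u + d * density k u) ->
  0 <= c -> 0 <= d ->
  moment m <= mass A m + (c * moment n + d * moment k).
Proof.
move=> mA h c0 d0; rewrite -Rintegral_density2 /mass -RintegralD//; last 2 first.
- exact: integrable_indic_density.
- exact: integrable_density2.
apply: le_Rintegral => //.
- exact: integrable_density.
- rewrite (_ : _ \o _ = (fun u => (\1_A u * density m u)%:E +
    (c * density n u + d * density k u)%:E)%E)//.
  apply: integrableD => //; first exact: integrable_indic_density.
  exact: integrable_density2.
- move=> u /=; rewrite in_itv/= andbT => u0; rewrite indicE.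
  case: (boolP (u \in A)) => [_|/negP uA].
    by rewrite mul1r lerDl density2_ge0.
  by rewrite mul0r add0r h// => /mem_set.
Qed.

Lemma mass_le_moment (A : set (measurableTypeR R)) m : measurable A ->
  mass A m <= moment m.
Proof.
move=> mA; rewrite -[moment m]addr0 -[moment m]mul1r -[0](mul0r (moment m)).
by apply: mass_le => // u u0 _; rewrite mul1r mul0r addr0.
Qed.

Lemma normc_real (x : R) : Normc.normc (x%:C) = `|x|.
Proof. by rewrite /Normc.normc/= expr0n/= addr0 sqrtr_sqr. Qed.

Lemma eigenvalue_indic (A : set R) m :
  eigenvalue_seq (@log32_weight R) (fun u => (\1_A u)%:C) m =
  (mass A m / moment m)%:C.
Proof.
rewrite /eigenvalue_seq /cintegral /=.
under eq_Rintegral do rewrite mul0r subr0.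
under [X in _ +i* X]eq_Rintegral do rewrite mul0r mulr0 add0r.
by rewrite Rintegral_cst// mul0r rmorphM fmorphV.
Qed.

Lemma indic_eigenvalue_seqs (A : set (measurableTypeR R)) : measurable A ->
  radial_eigenvalue_seqs (@log32_weight R) (fun m => (mass A m / moment m)%:C).
Proof.
move=> mA; exists (fun z => (\1_A (Normc.normc z))%:C), (fun u => (\1_A u)%:C).
have mindic : measurable_fun setT (\1_A : measurableTypeR R -> R) by exact: measurable_indic.
have mnorm : measurable_fun setT
    (fun z : measurableTypeR R * measurableTypeR R => Normc.normc (to_complex z)).
  apply: (measurableT_comp (f := @Num.sqrt R)).
    exact: (continuous_measurable_fun (@sqrt_continuous R)).
  by apply: measurable_funD; apply: measurable_funX.
split; last by apply/funext => m; rewrite eigenvalue_indic.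
- split.
    by split=> /=; [exact: measurableT_comp mnorm|exact: measurable_cst].
  apply: (@le_lt_trans _ _ 1%E); last exact: ltry.
  apply/ess_supP; apply: aeW => z.
  by rewrite normc_real lee_fin indicE; case: (_ \in _); rewrite ?normr1 ?normr0.
- split; last by apply: aeW.
  by split=> /=; [exact: measurable_funTS|exact: measurable_cst].
Qed.

(** * Construction of the oscillating set *)

(** Iterating [moment_step] gives [1 = s 0 <= b 0 <= s 1 <= b 1 <= ...], and [A] is the union of the
    [[b k, s k.+1[]. At least three quarters of the [p k]-th measure lie in the gap [[s k, b k[],
    and as much of the [(p k).+2]-nd in the next interval. The Markov bounds hold whatever [A] does
    elsewhere. *)
Lemma exists_oscillating_set : exists2 A : set (measurableTypeR R), measurable A &
  forall n, exists2 p, (n < p)%N &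
    mass A p <= moment p / 4 /\ moment p.+2 * (3 / 4) <= mass A p.+2.
Proof.
have /choice[f Hf] : forall kc : nat * R, exists x : nat * R * R, 1 <= kc.2 ->
    let: (p, b, d) := x in
  [/\ (kc.1 < p)%N, kc.2 <= b, b <= d,
      kc.2 ^+ (2 * p) * moment 0 + b ^- 2 * moment p.+1 <= moment p / 4 &
      b ^+ 2 * moment p.+1 + d ^- 2 * moment p.+3 <= moment p.+2 / 4].
  (* For [c < 1] the triple is a dummy; [s1] below shows that the recursion never meets this
     case. *)
  move=> [k c]/=; have [c1|c1] := pselect (1 <= c); last by exists (0%N, 0, 0).
  by have [x hx] := moment_step k c1; exists x.
pose fix s k : R := if k is k'.+1 then (f (k', s k')).2 else 1.
pose p k := (f (k, s k)).1.1; pose b k := (f (k, s k)).1.2.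
have s1 k : 1 <= s k.
  elim: k => //= k IH; have := Hf (k, s k) IH.
  by case: (f _) => [[p' b'] d'] [_ /= h1 h2 _ _]; lra.
have H k : [/\ (k < p k)%N, s k <= b k, b k <= s k.+1,
      s k ^+ (2 * p k) * moment 0 + b k ^- 2 * moment (p k).+1 <= moment (p k) / 4 &
      b k ^+ 2 * moment (p k).+1 + s k.+1 ^- 2 * moment (p k).+3 <= moment (p k).+2 / 4].
  by have := Hf (k, s k) (s1 k); rewrite /p /b /=; case: (f _) => [[? ?] ?].
have b1 k : 1 <= b k by have [_ h _ _ _] := H k; exact: le_trans h.
have s_le i j : (i <= j)%N -> s i <= s j.
  move=> /subnK <-; elim: (j - i)%N => //= l IH; apply: le_trans IH _.
  by have [_ h1 h2 _ _] := H (l + i)%N; exact: le_trans h2.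
pose A : set (measurableTypeR R) := \bigcup_k [set` `[b k, s k.+1[].
have mA : measurable A by apply: bigcup_measurable => k _; exact: measurable_itv.
exists A => //.
(* [A] misses the gap [[s k, b k[]: intervals of smaller index end by [s k], the others start at
   [b k] or later. *)
have Acap k u : A u -> u < s k \/ b k <= u.
  move=> [l _ /=]; rewrite in_itv/= => /andP[blu usl].
  have [lk|kl|<-] := ltngtP l k.
  - left; exact: lt_le_trans usl (s_le l.+1 k lk).
  - right; apply: le_trans blu; have [_ _ h _ _] := H k; have [_ h' _ _ _] := H l.
    exact: le_trans h (le_trans (s_le k.+1 l kl) h').
  - by right.
(* Markov's inequality at the level of densities: [1 <= u^2 / x^2] for [u >= x]. *)
have dens_le x i u : 0 < x -> 0 <= u -> x <= u -> density i u <= x ^- 2 * density i.+1 u.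
  move=> x0 u0 xu; rewrite densityS mulrA ler_peMl ?density_ge0//.
  by rewrite mulrC ler_pdivlMr ?exprn_gt0// mul1r lerXn2r ?nnegrE// ltW.
move=> k; have [kp sb bs h1 h2] := H k; exists (p k) => //; split.
  apply: le_trans h1; apply: mass_le => //.
  - move=> u u0 Au; have [us|bu] := Acap k u Au.
      apply: (@le_trans _ _ (s k ^+ (2 * p k) * density 0 u)).
        rewrite -[p k]add0n densityD ler_wpM2r ?density_ge0// lerXn2r ?nnegrE ?(ltW us)//.
        exact: le_trans ler01 (s1 k).
      by rewrite lerDl mulr_ge0 ?invr_ge0 ?sqr_ge0// density_ge0.
    apply: (le_trans (dens_le _ _ _ _ u0 bu)); first exact: lt_le_trans (b1 k).
    by rewrite lerDr mulr_ge0 ?density_ge0// exprn_ge0// (le_trans ler01).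
  - by rewrite exprn_ge0// (le_trans ler01).
  - by rewrite invr_ge0 sqr_ge0.
have h : moment (p k).+2 <= mass A (p k).+2 +
    (b k ^+ 2 * moment (p k).+1 + s k.+1 ^- 2 * moment (p k).+3).
  apply: mass_ge; rewrite ?invr_ge0 ?sqr_ge0// => u u0 nAu.
  have [ub|bu] := ltP u (b k).
    apply: (@le_trans _ _ (b k ^+ 2 * density (p k).+1 u)).
      rewrite densityS ler_wpM2r ?density_ge0// lerXn2r ?nnegrE ?(ltW ub)//.
      exact: le_trans ler01 (b1 k).
    by rewrite lerDl mulr_ge0 ?invr_ge0 ?sqr_ge0// density_ge0.
  have su : s k.+1 <= u.
    rewrite leNgt; apply/negP => us; apply: nAu; exists k => //=.
    by rewrite in_itv/= bu.
  apply: (le_trans (dens_le _ _ _ _ u0 su)); first exact: lt_le_trans (s1 k.+1).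
  by rewrite lerDr mulr_ge0 ?sqr_ge0// density_ge0.
lra.
Qed.

End moments.

(** * Failure of uniform continuity *)

(** The difference of the roots is [2 / (b + a) <= 1 / a] with [a = sqrt m], and [1 / a < d] once
    [m > d ^- 2]. *)
Lemma sqrt_metric_add2_lt (R : realType) (d : R) : 0 < d ->
  exists n, forall m, (n <= m)%N -> sqrt_metric R m m.+2 < d.
Proof.
move=> d0; exists (Num.trunc (d ^- 2)).+1 => m nm.
have hm : d ^- 2 < m%:R.
  by apply: lt_le_trans (truncnS_gt _) _; rewrite ler_nat.
rewrite /sqrt_metric.
set a := Num.sqrt m%:R; set b := Num.sqrt m.+2%:R.
have aa : a ^+ 2 = m%:R by rewrite sqr_sqrtr.
have bb : b ^+ 2 = m%:R + 2 by rewrite sqr_sqrtr// -addn2 natrD.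
have ab : a <= b by rewrite ler_wsqrtr// ler_nat; lia.
have a0 : 0 <= a by exact: sqrtr_ge0.
have ad : 1 < d * a.
  have : 1 < (d * a) ^+ 2.
    by rewrite exprMn aa mulrC -ltr_pdivrMr ?exprn_gt0// div1r.
  have : 0 <= d * a by rewrite mulr_ge0// ltW.
  nra.
rewrite distrC ger0_norm ?subr_ge0// ltNge; apply/negP => h.
nra.
Qed.

Theorem corollary9p1 (R : realType) :
  ell_infty_closure (radial_eigenvalue_seqs (@log32_weight R)) <>
  @bounded_sqrt_unif_continuous R.
Proof.
have [A mA osc] := @exists_oscillating_set R.
move=> E.
pose lam m : R[i] := (mass A m / moment m)%:C.
have : ell_infty_closure (radial_eigenvalue_seqs (@log32_weight R)) lam.
  split; last by apply: subset_closure; exact: indic_eigenvalue_seqs.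
  exists 1 => n; rewrite normc_real ger0_norm ?divr_ge0 ?mass_ge0 ?moment_ge0//.
  (* Positivity of the moments was shown for positive indices only; were [moment n] zero, the
     quotient would be 0 by the convention for inverses. *)
  have [->|M0] := eqVneq (@moment R n) 0; first by rewrite invr0 mulr0.
  by rewrite ler_pdivrMr ?mul1r ?mass_le_moment// lt_def M0 moment_ge0.
(* The tolerance [1 / 2] is the jump from [1 / 4] to [3 / 4] between [p] and [p.+2]. *)
rewrite E => -[_ /(_ (1 / 2))[|d d0 uc]]; first by lra.
have [n hn] := sqrt_metric_add2_lt d0.
have [p np [h1 h2]] := osc n.
have := uc _ _ (hn p (ltnW np)).
have Mp : 0 < moment p :> R by apply: moment_gt0; exact: leq_ltn_trans np.
have Mp2 : 0 < moment p.+2 :> R by exact: moment_gt0.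
rewrite /lam -rmorphB normc_real distrC.
have l1 : mass A p / moment p <= 1 / 4 by rewrite ler_pdivrMr//; lra.
have l2 : 3 / 4 <= mass A p.+2 / moment p.+2 by rewrite ler_pdivlMr//; lra.
by rewrite ger0_norm; lra.
Qed.
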